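(* Let $\mathrm{L}$ be a relational $\omega$-signature and $T$ a set of $\mathrm{L}_{\infty\omega}$-sentences which is Boolean satisfiable. Let $\mathcal{F}$ be a set such that each $\Phi\in\mathcal{F}$ is a set of $\mathrm{L}_{\infty\omega}$-formulae all of whose free variables are among $v_0,\dots,v_{n_\Phi-1}$. Let $\mathrm{L}_{T,\mathcal F}$ be the smallest fragment of $\mathrm{L}_{\infty\omega}$ containing $T$ and every $\Phi\in\mathcal F$. Suppose that for every $\Phi\in\mathcal F$ and every $\mathrm{L}_{T,\mathcal F}$-formula $\theta$ with free variables among $v_0,\dots,v_{n_\theta-1}$: $T\cup\{\exists v_0\dots v_{n_\theta-1}\,\theta\}$ is Boolean satisfiable if and only if $T\cup\{\exists v_0\dots v_{\max\{n_\theta-1,n_\Phi-1\}}\,[\theta\wedge\phi]\}$ is Boolean satisfiable for some $\phi\in\Phi$. Then there exist a complete Boolean algebra $\mathsf{B}$ and a $\mathsf{B}$-valued model $\mathcal M$ with the mixing property such that $$\mathcal M\models T\cup\Big\{\bigwedge_{\Phi\in\mathcal F}\forall v_0\dots v_{n_\Phi-1}\bigvee\Phi\Big\}.$$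
   Context: A relational $\omega$-signature consists of finitary relation symbols and constant symbols only. $\mathrm{L}_{\kappa\omega}$-formulae are built from atomic formulae by $\neg$, by $\bigwedge\Phi$, $\bigvee\Phi$ for sets $\Phi$ of fewer than $\kappa$ formulae with jointly finitely many free variables, and by $\forall V,\exists V$ for finite sets $V$ of variables; $\mathrm{L}_{\infty\omega}=\bigcup_\kappa\mathrm{L}_{\kappa\omega}$. For a formula $\phi$, $\phi\neg$ is defined by: $\phi\neg=\neg\phi$ for atomic $\phi$; $(\neg\chi)\neg=\chi$; $(\bigwedge\Phi)\neg=\bigvee\{\neg\chi:\chi\in\Phi\}$; $(\bigvee\Phi)\neg=\bigwedge\{\neg\chi:\chi\in\Phi\}$; $(\forall\bar v\chi)\neg=\exists\bar v\neg\chi$; $(\exists\bar v\chi)\neg=\forall\bar v\neg\chi$. A fragment of $\mathrm{L}_{\kappa\omega}$ is a set $\mathrm{L}_{\mathcal A}$ of $\mathrm{L}_{\kappa\omega}$-formulae closed under $\neg$, $\wedge$, $\vee$, under $\forall v$ and $\exists v$ for variables $v$ occurring in formulae of $\mathrm{L}_{\mathcal A}$, under subformulae, under $\phi\mapsto\phi\neg$, under substitution of terms for variables and of variables occurring in $\mathrm{L}_{\mathcal A}$ for variables, and such that for each $\phi\in\mathrm{L}_{\mathcal A}$ some variable occurring in $\mathrm{L}_{\mathcal A}$ does not occur in $\phi$. For a complete Boolean algebra $\mathsf{B}$, a $\mathsf{B}$-valued model is a nonempty set $M$ with $\mathsf{B}$-valued equality and relations (satisfying reflexivity, symmetry, transitivity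 of equality in the Boolean sense and the substitution inequality $\bigwedge_i[\![\tau_i=\sigma_i]\!]\wedge[\![R(\bar\tau)]\!]\le[\![R(\bar\sigma)]\!]$) and interpretations of constants; values of formulae are computed recursively with $\neg$ as complement, infinitary connectives as infima/suprema and quantifiers as infima/suprema over $M$. $\mathcal M\models T$ means $[\![\bigwedge T]\!]=1_{\mathsf{B}}$. A set of sentences is Boolean satisfiable if it holds with value $1$ in some $\mathsf{B}$-valued model for some complete $\mathsf{B}$. The mixing property: for every antichain $A\subseteq\mathsf{B}$ and $\{\tau_a:a\in A\}\subseteq M$ there is $\tau\in M$ with $a\le[\![\tau=\tau_a]\!]$ for all $a\in A$.
   Formalization: The fragment L_{T,F} is generated by T, the members of F and also all equalities v_i = v_j; with fragments not required to contain atomic formulae the claim fails, e.g. for T empty and the single type {not (P_k v_0 <-> P_k v_1) : k}. *)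

(* Defs.v *)
From HB Require Import structures.
From mathcomp Require Import all_boot all_order finmap.
From mathcomp Require Import boolp classical_sets functions cardinality.

Set Implicit Arguments.
Unset Strict Implicit.
Unset Printing Implicit Defensive.

Local Open Scope classical_set_scope.

Record signature := Signature {
  rsym : Type;
  arity : rsym -> nat;
  csym : Type }.

Section Syntax.
Variables (L : signature) (V : choiceType).

Inductive term := Var of V | Cst of csym L.

(* A set of formulae under a conjunction or disjunction is presented as a
   family indexed by an arbitrary type, so that no cardinal bound is imposed;
   the condition of jointly finitely many free variables is [Linf] below. *)
Inductive formula :=
| Eq of term & term
| Rel (R : rsym L) of 'I_(arity R) -> term
| Not of formula
| And (I : Type) of I -> formula
| Or (I : Type) of I -> formula
| All of {fset V} & formula
| Ex of {fset V} & formula.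

Definition and2 (p q : formula) := And (fun b : bool => if b then p else q).
Definition or2 (p q : formula) := Or (fun b : bool => if b then p else q).

Definition tvar (t : term) : set V :=
  match t with Var x => [set x] | Cst _ => set0 end.

Fixpoint FV (p : formula) : set V :=
  match p with
  | Eq t s => tvar t `|` tvar s
  | Rel _ a => \bigcup_i tvar (a i)
  | Not q => FV q
  | And _ f | Or _ f => \bigcup_i FV (f i)
  | All W q | Ex W q => FV q `\` [set` W]
  end.

(* All variables of a formula, including those that are only quantified. *)
Fixpoint occurs (p : formula) : set V :=
  match p with
  | Eq t s => tvar t `|` tvar s
  | Rel _ a => \bigcup_i tvar (a i)
  | Not q => occurs q
  | And _ f | Or _ f => \bigcup_i occurs (f i)
  | All W q | Ex W q => occurs q `|` [set` W]
  end.

Fixpoint Linf (p : formula) : Prop :=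
  match p with
  | Eq _ _ | Rel _ _ => True
  | Not q | All _ q | Ex _ q => Linf q
  | And _ f | Or _ f =>
      (forall i, Linf (f i)) /\ finite_set (\bigcup_i FV (f i))
  end.

Definition sentence (p : formula) := Linf p /\ FV p = set0.

Definition neg_inside (p : formula) : formula :=
  match p with
  | Eq _ _ | Rel _ _ => Not p
  | Not q => q
  | And _ f => Or (fun i => Not (f i))
  | Or _ f => And (fun i => Not (f i))
  | All W q => Ex W (Not q)
  | Ex W q => All W (Not q)
  end.

Definition imm_subformula (q p : formula) : Prop :=
  match p with
  | Eq _ _ | Rel _ _ => False
  | Not r | All _ r | Ex _ r => q = r
  | And _ f | Or _ f => exists i, q = f i
  end.

Definition tsubst (x : V) (t s : term) : term :=
  match s with Var y => if y == x then t else s | Cst _ => s end.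

(* Replaces the free occurrences of x by t; see [free_for] for capture. *)
Fixpoint subst (x : V) (t : term) (p : formula) : formula :=
  match p with
  | Eq s r => Eq (tsubst x t s) (tsubst x t r)
  | Rel _ a => Rel (fun i => tsubst x t (a i))
  | Not q => Not (subst x t q)
  | And _ f => And (fun i => subst x t (f i))
  | Or _ f => Or (fun i => subst x t (f i))
  | All W q => if x \in W then p else All W (subst x t q)
  | Ex W q => if x \in W then p else Ex W (subst x t q)
  end.

Fixpoint free_for (x : V) (t : term) (p : formula) : Prop :=
  match p with
  | Eq _ _ | Rel _ _ => True
  | Not q => free_for x t q
  | And _ f | Or _ f => forall i, free_for x t (f i)
  | All W q | Ex W q =>
      ~ FV p x \/ (tvar t `&` [set` W] = set0 /\ free_for x t q)
  end.

Definition occurs_in (A : set formula) : set V := \bigcup_(p in A) occurs p.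

Record fragment (A : set formula) : Prop := Fragment {
  frag_Linf : A `<=` Linf;
  frag_not : forall p, A p -> A (Not p);
  frag_and : forall p q, A p -> A q -> A (and2 p q);
  frag_or : forall p q, A p -> A q -> A (or2 p q);
  frag_all : forall p x, A p -> occurs_in A x -> A (All [fset x]%fset p);
  frag_ex : forall p x, A p -> occurs_in A x -> A (Ex [fset x]%fset p);
  frag_sub : forall p q, A p -> imm_subformula q p -> A q;
  frag_neg : forall p, A p -> A (neg_inside p);
  (* A term that is not a constant is a variable, and only the variables that
     occur in A may be substituted. *)
  frag_subst : forall p x t, A p -> tvar t `<=` occurs_in A ->
    free_for x t p -> A (subst x t p);
  frag_fresh : forall p, A p -> exists2 x, occurs_in A x & ~ occurs p x }.

(* A fragment has infinitely many variables, and which ones is not determined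
   by X when X has too few of them, so that in general there is no least
   fragment containing X outright: A is the least one among those whose
   variables include the variables of A. *)
Definition smallest_fragment (X A : set formula) : Prop :=
  [/\ fragment A, X `<=` A
    & forall A' : set formula, fragment A' -> X `<=` A' ->
        occurs_in A `<=` occurs_in A' -> A `<=` A'].

(* Closure as a fragment does not produce atomic formulae, while a fragment
   without equality cannot force two of the variables v_i to denote the same
   element; these equalities are therefore put among the generators. *)
Definition var_equalities (v : nat -> V) : set formula :=
  [set p | exists i j, p = Eq (Var (v i)) (Var (v j))].

Definition first_vars (v : nat -> V) (n : nat) : {fset V} :=
  [fset v i | i in iota 0 n]%fset.

End Syntax.

Section Semantics.
Variables (L : signature) (V : choiceType).
Variables (d : Order.disp_t) (B : ctbDistrLatticeType d).
Local Open Scope order_scope.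

Definition complete_boolean : Prop :=
  \bot != \top :> B /\ forall X : set B, supremums X !=set0.

Record bmodel := BModel {
  dom :> Type;
  dom_inh : inhabited dom;
  beq : dom -> dom -> B;
  brel : forall R : rsym L, ('I_(arity R) -> dom) -> B;
  bcst : csym L -> dom;
  beq_refl : forall x, beq x x = \top;
  beq_sym : forall x y, beq x y = beq y x;
  beq_trans : forall x y z, Order.meet (beq x y) (beq y z) <= beq x z;
  brel_subst : forall (R : rsym L) (a b : 'I_(arity R) -> dom),
    Order.meet (\meet_(i < arity R) beq (a i) (b i)) (brel a) <= brel b }.

Variable M : bmodel.

Definition teval (e : V -> M) (t : term L V) : M :=
  match t with Var x => e x | Cst c => bcst M c end.

Definition variants (e : V -> M) (W : {fset V}) : set (V -> M) :=
  [set e' | forall x, x \notin W -> e' x = e x].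

Fixpoint value (e : V -> M) (p : formula L V) : B :=
  match p with
  | Eq t s => beq (teval e t) (teval e s)
  | Rel _ a => brel (fun i => teval e (a i))
  | Not q => Order.compl (value e q)
  | And _ f => infimum \top (range (fun i => value e (f i)))
  | Or _ f => supremum \bot (range (fun i => value e (f i)))
  | All W q => infimum \top [set value e' q | e' in variants e W]
  | Ex W q => supremum \bot [set value e' q | e' in variants e W]
  end.

Definition models (T : set (formula L V)) : Prop :=
  forall e : V -> M, infimum \top [set value e p | p in T] = \top.

Definition mixing : Prop :=
  forall X : set B,
    (forall a b, X a -> X b -> a <> b -> Order.meet a b = \bot) ->
    forall tau : B -> M,
      exists m : M, forall a, X a -> a <= beq m (tau a).

End Semantics.

Definition boolean_satisfiable (L : signature) (V : choiceType)
    (T : set (formula L V)) : Prop :=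
  exists (d : Order.disp_t) (B : ctbDistrLatticeType d) (M : bmodel L B),
    complete_boolean B /\ models M T.

(* Main.v *)
(** Conditions are finite sets of formulae of the fragment about finitely many
    names; two conditions are incompatible when their conjunction has value 0 in
    every Boolean valued model of T.  The sets of conditions that equal their
    double polar for incompatibility form a complete Boolean algebra, and the
    names form a model over it in which the value of a formula p of the fragment
    is the set of the conditions that entail p.  If a condition q were
    incompatible with all the instances of Phi at a tuple of names, then the
    formula theta(v_0, v_1, ...) saying that v_0, ..., v_(n-1) is that tuple and
    that q holds would be satisfiable with T, but not together with any element
    of Phi, against the hypothesis.  Functions x |-> [m = x] then adjoin the
    mixtures without changing the values of formulae. *)

Require Import Defs.
From HB Require Import structures.
From mathcomp Require Import all_boot all_order finmap.
From mathcomp Require Import boolp classical_sets functions cardinality.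

Set Implicit Arguments.
Unset Strict Implicit.
Unset Printing Implicit Defensive.

Import Order.Theory.
Local Open Scope classical_set_scope.

(** * Suprema and infima in a complete Boolean algebra *)

Section CompleteAlgebra.
Variables (d : Order.disp_t) (B : ctbDistrLatticeType d).
Hypothesis cB : complete_boolean B.
Local Open Scope order_scope.
Implicit Types (X Y : set B) (a b c x y : B).

Lemma leI_compl a b c : (a `&` b <= c) = (a <= ~` b `|` c).
Proof.
apply/idP/idP => [h|h]; last first.
  by rewrite (le_trans (leI2 h (lexx b)))// meetUl meetCx join0x leIl.
by rewrite -[a](meetx1) -(joinxC b) meetUr joinC leU2// leIr.
Qed.

(** [supremum] falls back on its default for the empty set and for a set without a supremum.
    Completeness excludes the second case, and [\bot] is the correct value in the first. *)
Lemma sup_ub X x : X x -> x <= supremum \bot X.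
Proof.
move=> Xx; rewrite /supremum; case: ifPn => [/eqP X0|_].
  by move: Xx; rewrite X0.
case: xgetP => [y _ [+ _]|none]; first exact.
by have [y] := cB.2 X; move/none.
Qed.

Lemma sup_le X c : (forall x, X x -> x <= c) -> supremum \bot X <= c.
Proof.
move=> h; rewrite /supremum; case: ifPn => [_|_]; first exact: le0x.
by case: xgetP => [y _ [_ /(_ c)]|_]; [apply|exact: le0x].
Qed.

(** By De Morgan, the complement of a supremum of the complements is an infimum. *)
Lemma infimums_ex X : infimums X !=set0.
Proof.
have [y [ub lub]] := cB.2 [set ~` x | x in X].
exists (~` y); split.
  by move=> x Xx; rewrite leCx; apply: ub; exists x.
move=> z zX; rewrite lexC; apply: lub => _ [x Xx <-]; rewrite leC; exact: zX.
Qed.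

Lemma inf_lb X x : X x -> infimum \top X <= x.
Proof.
move=> Xx; rewrite /infimum; case: ifPn => [/eqP X0|_].
  by move: Xx; rewrite X0.
case: xgetP => [y _ [+ _]|none]; first exact.
by have [y] := infimums_ex X; move/none.
Qed.

Lemma le_inf X c : (forall x, X x -> c <= x) -> c <= infimum \top X.
Proof.
move=> h; rewrite /infimum; case: ifPn => [_|_]; first exact: lex1.
by case: xgetP => [y _ [_ /(_ c)]|_]; [apply|exact: lex1].
Qed.

(** Meet with [b] has a right adjoint by [leI_compl], hence distributes over arbitrary suprema. *)
Lemma supI_le X b c :
  (forall x, X x -> x `&` b <= c) -> supremum \bot X `&` b <= c.
Proof.
by move=> h; rewrite leI_compl; apply: sup_le => x /h; rewrite leI_compl.
Qed.

Lemma sup_unique X c : (forall x, X x -> x <= c) ->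
  (forall b, (forall x, X x -> x <= b) -> c <= b) -> supremum \bot X = c.
Proof. by move=> h1 h2; apply: le_anti; rewrite sup_le//= h2// => x; apply: sup_ub. Qed.

Lemma inf_unique X c : (forall x, X x -> c <= x) ->
  (forall b, (forall x, X x -> b <= x) -> b <= c) -> infimum \top X = c.
Proof. by move=> h1 h2; apply: le_anti; rewrite le_inf// andbT h2// => x; apply: inf_lb. Qed.

Lemma inf_eq1 X : infimum \top X = \top <-> forall x, X x -> x = \top.
Proof.
split=> [h x Xx|h]; last by apply: inf_unique => [x /h ->|b _]; rewrite lex1.
by apply/eqP; rewrite -le1x -h inf_lb.
Qed.

End CompleteAlgebra.

(* Only nullity of a product is observed, so that the laws of a meet
   semilattice are required up to nullity. *)
Record phase_space := PhaseSpace {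
  point :> Type;
  mul : point -> point -> point;
  null : point -> Prop;
  nullC : forall p q, null (mul p q) -> null (mul q p);
  nullK : forall p, null (mul p p) -> null p;
  nullW : forall p q, null p -> null (mul p q);
  nullA : forall p q r, null (mul (mul p q) r) <-> null (mul p (mul q r));
  nullKK : forall p r, null (mul p (mul p r)) -> null (mul p r) }.

Fact reg_display : Order.disp_t.
Proof. exact: Order.Disp tt tt. Qed.

(** * The Boolean algebra of sets equal to their double polar *)

Section RegularSets.
Variable P : phase_space.
Implicit Types (X Y Z : set P) (p q r : P).

Definition perp X : set P := [set q | forall p, X p -> null (mul p q)].

Lemma perpS X Y : X `<=` Y -> perp Y `<=` perp X.
Proof. by move=> XY q qY p /XY; apply: qY. Qed.

Lemma sub_perpK X : X `<=` perp (perp X).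
Proof. by move=> p Xp q; move/(_ _ Xp)/nullC. Qed.

Lemma perpKK X : perp (perp (perp X)) = perp X.
Proof. by apply/seteqP; split; [apply: perpS|]; apply: sub_perpK. Qed.

(** A product is a stronger condition than its factors, and polars are closed under
    strengthening. *)
Lemma perp_mulr X p q : perp X p -> perp X (mul p q).
Proof. by move=> Xp r Xr; apply/nullA/nullW/Xp. Qed.

Lemma perp_mull X p q : perp X p -> perp X (mul q p).
Proof.
by move=> Xp r Xr; apply/nullC/nullA/nullC/nullW/nullC/Xp.
Qed.

Lemma perpU X Y : perp (X `|` Y) = perp X `&` perp Y.
Proof.
apply/seteqP; split=> [p h|p [hX hY] q []]; [|exact: hX|exact: hY].
by split=> q Xq; apply: h; [left|right].
Qed.

Record reg := Reg { rset :> set P; rsetP : perp (perp rset) = rset }.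

Lemma reg_mulr (X : reg) p q : rset X p -> rset X (mul p q).
Proof. by rewrite -[rset X]rsetP; apply: perp_mulr. Qed.
Lemma reg_mull (X : reg) p q : rset X p -> rset X (mul q p).
Proof. by rewrite -[rset X]rsetP; apply: perp_mull. Qed.

Definition close X : reg := Reg (perpKK (perp X)).

Lemma reg_eq (X Y : reg) : (rset X = rset Y) -> X = Y.
Proof.
case: X Y => [X hX] [Y hY] /= XY; rewrite XY in hX *.
by congr Reg; apply: Prop_irrelevance.
Qed.

HB.instance Definition _ := gen_eqMixin reg.
HB.instance Definition _ := gen_choiceMixin reg.

Definition reg_le (X Y : reg) : bool := `[< rset X `<=` rset Y >].

Lemma reg_le_refl : reflexive reg_le.
Proof. by move=> X; apply/asboolP. Qed.
Lemma reg_le_anti : antisymmetric reg_le.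
Proof.
by move=> X Y /andP[/asboolP h1 /asboolP h2]; apply/reg_eq/seteqP.
Qed.
Lemma reg_le_trans : transitive reg_le.
Proof.
move=> Y X Z /asboolP h1 /asboolP h2; apply/asboolP; exact: subset_trans h2.
Qed.

HB.instance Definition _ := Order.Le_isPOrder.Build reg_display reg
  reg_le_refl reg_le_anti reg_le_trans.

Lemma regI_subproof (X Y : reg) : perp (perp (X `&` Y)) = X `&` Y.
Proof.
apply/seteqP; split; last exact: sub_perpK.
rewrite subsetI; split.
  by rewrite -[X in _ `<=` X]rsetP; do 2!apply: perpS; apply: subIsetl.
by rewrite -[X in _ `<=` X]rsetP; do 2!apply: perpS; apply: subIsetr.
Qed.

Definition reg_meet (X Y : reg) : reg := Reg (regI_subproof X Y).
Definition reg_join (X Y : reg) : reg := close (X `|` Y).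
Definition reg_compl (X : reg) : reg := Reg (perpKK X).
Definition reg_bot : reg := close set0.
Definition reg_top : reg := close setT.

Lemma closeP X (Y : reg) : (close X `<=` Y) <-> X `<=` Y.
Proof.
split=> [|h]; first by apply: subset_trans; apply: sub_perpK.
by rewrite -[rset Y]rsetP; do 2!apply: perpS.
Qed.

Lemma reg_bot_le (X : reg) : reg_le reg_bot X.
Proof. by apply/asboolP/closeP. Qed.
Lemma reg_le_top (X : reg) : reg_le X reg_top.
Proof. by apply/asboolP => p _; apply: sub_perpK. Qed.

HB.instance Definition _ :=
  Order.hasBottom.Build reg_display reg reg_bot_le.
HB.instance Definition _ :=
  Order.hasTop.Build reg_display reg reg_le_top.

Lemma reg_lexI (X Y Z : reg) :
  reg_le X (reg_meet Y Z) = reg_le X Y && reg_le X Z.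
Proof.
apply/asboolP/andP => [|[/asboolP h1 /asboolP h2]]; last by rewrite subsetI.
by rewrite subsetI => -[? ?]; split; apply/asboolP.
Qed.

Lemma reg_leUx (X Y Z : reg) :
  reg_le (reg_join X Y) Z = reg_le X Z && reg_le Y Z.
Proof.
apply/asboolP/andP => [/closeP|[/asboolP h1 /asboolP h2]]; last first.
  by apply/closeP; rewrite subUset.
by rewrite subUset => -[? ?]; split; apply/asboolP.
Qed.

HB.instance Definition _ := Order.POrder_MeetJoin_isLattice.Build
  reg_display reg reg_lexI reg_leUx.

(** Let [p] lie in the join of [X] and [Y] and in [Z], and let [r] be in the polar of the right-hand
    side. For [q] in [X] or [Y] the product of [q] and [p] lies in one of the two meets, so
    [mul p r] is in the polar of both [X] and [Y]. Hence its product with [p] is null, and [nullKK]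
    removes the repeated factor. *)
Lemma reg_meetUl : @left_distributive reg reg reg_meet reg_join.
Proof.
move=> X Y Z; apply: le_anti; apply/andP; split; last first.
  rewrite leUx; apply/andP; split; apply/asboolP; rewrite /= !subsetI; split;
    try exact: subIsetr; apply: subset_trans (@sub_perpK _);
    move=> p [] ? ?; by [left|right].
apply/asboolP => p [pXY pZ] r.
rewrite perpU => -[rX rY]; apply/nullC/nullKK/nullC/pXY.
rewrite perpU; split=> q Xq; apply/nullA.
- by apply: rX; split; [apply: reg_mulr|apply: reg_mull].
- by apply: rY; split; [apply: reg_mulr|apply: reg_mull].
Qed.

HB.instance Definition _ := Order.Lattice_Meet_isDistrLattice.Build
  reg_display reg reg_meetUl.

Lemma perpT p : perp setT p <-> null p.
Proof. by split=> [h|h q _]; [apply/nullK/h|apply/nullC/nullW]. Qed.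

Lemma reg_botE p : rset reg_bot p <-> null p.
Proof.
rewrite /= -perpT; suff -> : perp (@set0 P) = setT by [].
by apply/seteqP; split => // q _ r [].
Qed.

Lemma reg_topE p : rset reg_top p.
Proof. exact: sub_perpK. Qed.

Lemma reg_joinxC (X : reg) : Order.join X (reg_compl X) = Order.top.
Proof.
apply/eqP; rewrite -le1x; apply/asboolP => p _.
change (rset (reg_join X (reg_compl X)) p) => q.
by rewrite perpU/= rsetP => -[h1 h2]; apply/nullW/nullK/h1.
Qed.

Lemma reg_meetxC (X : reg) : Order.meet X (reg_compl X) = Order.bottom.
Proof.
apply/eqP; rewrite -lex0; apply/asboolP => p [Xp h].
change (rset reg_bot p); by apply/reg_botE/nullK/h.
Qed.

HB.instance Definition _ := Order.TBDistrLattice_hasComplement.Build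
  reg_display reg reg_joinxC reg_meetxC.

Lemma reg_leP (X Y : reg) : reflect (rset X `<=` rset Y) (X <= Y)%O.
Proof. exact: asboolP. Qed.

(** The bottom consists of the null points only, so a point that is not null separates it from the
    top. Suprema are closures of unions. *)
Lemma reg_complete : (exists p : P, ~ null p) -> complete_boolean reg.
Proof.
move=> [p pn]; split.
  apply/eqP => bt; apply/pn/reg_botE; suff -> : reg_bot = reg_top by apply: reg_topE.
  exact: bt.
move=> S; exists (close (\bigcup_(X in S) rset X)); split.
  move=> X SX; apply/reg_leP => q Xq; apply: sub_perpK; by exists X.
by move=> X SX; apply/reg_leP/closeP => q [Y SY Yq]; move/(_ _ SY)/reg_leP: SX; apply.
Qed.

Lemma reg_topP (X : reg) : X = Order.top <-> forall p, rset X p.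
Proof.
split=> [-> p|h]; first exact: reg_topE.
by apply/eqP; rewrite -le1x; apply/reg_leP => p _.
Qed.

Lemma reg_complE (X : reg) : rset (Order.compl X) = perp X.
Proof. by []. Qed.

End RegularSets.

Arguments closeP {P X Y}.

(** * Boolean values of formulae and their dependence on the assignment *)

Section Values.
Variables (L : signature) (V : choiceType).
Variables (d : Order.disp_t) (B : ctbDistrLatticeType d).
Hypothesis cB : complete_boolean B.
Variable M : bmodel L B.
Local Open Scope order_scope.
Implicit Types (e g : V -> M) (p : formula L V) (t : term L V) (b c : B).

Lemma modelsP (T : set (formula L V)) :
  models M T <-> forall e p, T p -> value e p = \top.
Proof.
split=> [h e p Tp|h e].
  by apply: (inf_eq1 cB [set value e q | q in T]).1 => //; exists p.
by apply/(inf_eq1 cB) => _ [p Tp <-]; apply: h.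
Qed.

Lemma beq_congr (x x' y y' : M) b :
  b <= beq x x' -> b <= beq y y' -> b `&` beq x y <= beq x' y'.
Proof.
move=> bx bY; apply: le_trans (beq_trans x' y y').
rewrite lexI; apply/andP; split; last exact: leIxl.
apply: le_trans (beq_trans x' x y).
by rewrite leI2// beq_sym.
Qed.

Lemma teval_congr e e' t b : (forall x, tvar t x -> b <= beq (e x) (e' x)) ->
  b <= beq (teval e t) (teval e' t).
Proof. by case: t => [x|c] /= h; [apply: h|rewrite beq_refl lex1]. Qed.

Definition override (W : {fset V}) e g : V -> M :=
  fun x => if x \in W then g x else e x.

Lemma override_variant W e g : variants e W (override W e g).
Proof. by move=> x /negbTE xW; rewrite /override xW. Qed.

Lemma override_congr W p e e' g b : variants e' W g ->
  (forall x, (FV p `\` [set` W]) x -> b <= beq (e x) (e' x)) ->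
  forall x, FV p x -> b <= beq (override W e g x) (g x).
Proof.
move=> ge h x px; rewrite /override; case: ifPn => xW; first by rewrite beq_refl lex1.
by rewrite ge//; apply: h; split => //; apply/negP.
Qed.

(** This extends the substitution inequality from atomic formulae to all formulae. Negation
    exchanges [e] and [e'], which the symmetry of equality permits. *)
Lemma value_congr p e e' b : (forall x, FV p x -> b <= beq (e x) (e' x)) ->
  b `&` value e p <= value e' p.
Proof.
elim: p e e' => [t s|R a|q IH|K f IH|K f IH|W q IH|W q IH] e e' /= h.
- by apply: beq_congr; apply: teval_congr => x xt; apply: h; [left|right].
- apply: le_trans (brel_subst (fun i => teval e (a i)) _); rewrite leI2//.
  by apply/meetsP => i _; apply: teval_congr => x xt; apply: h; exists i.
- rewrite -disj_leC -lex0 -meetA [X in _ `&` X]meetC meetA.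
  rewrite -(meetxC (value e q)) leI2// IH// => x qx; rewrite beq_sym; exact: h.
- apply: le_inf => // _ [i _ <-]; apply: le_trans (IH i e e' _); last first.
    by move=> x xi; apply: h; exists i.
  by rewrite leI2//; apply: inf_lb => //; exists i.
- rewrite meetC; apply: supI_le => // _ [i _ <-]; rewrite meetC.
  apply: le_trans (IH i e e' _) _; first by move=> x xi; apply: h; exists i.
  by apply: sup_ub => //; exists i.
(* A variant [g] of [e'] is matched with the variant of [e] that follows [g] on [W]. *)
- apply: le_inf => // _ [g ge <-].
  apply: le_trans (IH (override W e g) g _); last exact: override_congr h.
  rewrite leI2//; apply: inf_lb => //.
  by exists (override W e g) => //; apply: override_variant.
- rewrite meetC; apply: supI_le => // _ [g ge <-]; rewrite meetC.
  apply: le_trans (IH g (override W e' g) _) _.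
    move=> x qx; rewrite beq_sym; move: x qx; apply: override_congr ge _.
    by move=> x qx; rewrite beq_sym; apply: h.
  by apply: sup_ub => //; exists (override W e' g) => //; apply: override_variant.
Qed.

Lemma value_eq p e e' : (forall x, FV p x -> e x = e' x) -> value e p = value e' p.
Proof.
move=> h; apply: le_anti; apply/andP; split.
  rewrite -[X in X <= _]meet1x; apply: value_congr => x /h ->.
  by rewrite beq_refl.
rewrite -[X in X <= _]meet1x; apply: value_congr => x /h ->.
by rewrite beq_refl.
Qed.

Lemma value_and2 e p q : value e (and2 p q) = value e p `&` value e q.
Proof.
apply: (inf_unique cB) => [_ [[] _ <-]|b h]; rewrite ?leIl ?leIr// lexI.
by rewrite (h (value e p))/= ?(h (value e q))//; [exists false|exists true].
Qed.

Lemma value_ex_ge e g W p : (forall x, FV p x -> x \notin W -> g x = e x) ->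
  value g p <= value e (Ex W p).
Proof.
move=> h; apply: sup_ub => //; exists (override W e g); first exact: override_variant.
by apply: value_eq => x px; rewrite /override; case: ifPn => // xW; rewrite h.
Qed.

End Values.

Lemma Linf_FV_finite (L : signature) (V : choiceType) (p : formula L V) :
  Linf p -> finite_set (FV p).
Proof.
have fint (t : term L V) : finite_set (tvar t).
  by case: t => [x|c] /=; [apply: finite_set1|apply: finite_set0].
elim: p => [t s|R a|q IH|K f IH|K f IH|W q IH|W q IH] /=.
- by move=> _; rewrite finite_setU; split.
- by move=> _; apply: bigcup_finite.
- exact: IH.
- by case.
- by case.
- by move=> /IH; apply: finite_setD.
- by move=> /IH; apply: finite_setD.
Qed.

(** * Relativization of a Boolean valued model to a nonzero value *)

Section Relativization.
Variables (L : signature) (V : choiceType).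
Variables (d : Order.disp_t) (B : ctbDistrLatticeType d).
Hypothesis cB : complete_boolean B.
Variables (M : bmodel L B) (b : B).
Hypothesis b_neq0 : (b != \bot)%O.
Local Open Scope order_scope.

(** With this notion of nullity the regular sets are a copy of the interval below [b], so that the
    Boolean structure built above can be reused for it. *)
Definition below_null (z : B) : Prop := z `&` b <= \bot.

Lemma below_nullC x y : below_null (x `&` y) -> below_null (y `&` x).
Proof. by rewrite meetC. Qed.
Lemma below_nullK x : below_null (x `&` x) -> below_null x.
Proof. by rewrite meetxx. Qed.
Lemma below_nullW x y : below_null x -> below_null (x `&` y).
Proof. by apply: le_trans; rewrite leI2// leIl. Qed.
Lemma below_nullA x y z :
  below_null (x `&` y `&` z) <-> below_null (x `&` (y `&` z)).
Proof. by rewrite meetA. Qed.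
Lemma below_nullKK x y : below_null (x `&` (x `&` y)) -> below_null (x `&` y).
Proof. by rewrite meetA meetxx. Qed.

Definition below : phase_space := PhaseSpace below_nullC below_nullK
  below_nullW below_nullA below_nullKK.

(** This set represents the trace of [c] below [b]; it is written as a polar to make its regularity
    immediate. *)
Definition restr (c : B) : reg below := Reg (perpKK (P := below) [set ~` c]).

Lemma restrP c (q : B) : rset (restr c) q <-> q `&` b <= c.
Proof.
split=> [/(_ _ erefl)|h p ->].
  by rewrite /= /below_null -meetA meetC leI_compl complK joinx0.
by rewrite /= /below_null -meetA meetC leI_compl complK joinx0.
Qed.

Lemma below_complete : complete_boolean (reg below).
Proof.
by apply: reg_complete; exists \top; rewrite /= /below_null meet1x lex0; apply/negP.
Qed.

Lemma restr_eq (c : B) (X : reg below) :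
  (forall q, rset X q <-> q `&` b <= c) -> restr c = X.
Proof. by move=> h; apply/reg_eq/seteqP; split=> q; rewrite restrP h. Qed.

Lemma restr_le c c' : c <= c' -> restr c <= restr c'.
Proof. by move=> h; apply/reg_leP => q /restrP qc; apply/restrP/(le_trans qc). Qed.

Lemma restr1 c : b <= c -> restr c = \top.
Proof. by move=> h; apply/reg_topP => q; apply/restrP; rewrite leIxr. Qed.

Lemma restrI : {morph restr : x y / x `&` y}.
Proof.
move=> x y; apply: restr_eq => q; rewrite lexI; split=> [[/restrP-> /restrP->]//|].
by move=> /andP[? ?]; split; apply/restrP.
Qed.

Lemma restrC c : restr (~` c) = ~` restr c.
Proof.
apply: restr_eq => q; rewrite reg_complE; split=> [h|h p /restrP pc].
  rewrite -disj_leC -lex0 meetC meetA; apply: h.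
  by apply/restrP; rewrite leIl.
rewrite /= /below_null -(meetxC c) lexI; apply/andP; split.
  by apply: le_trans pc; rewrite leI2// leIl.
by apply: le_trans h; rewrite leI2// leIr.
Qed.

Lemma restr_inf (X : set B) : restr (infimum \top X) = infimum \top (restr @` X).
Proof.
apply/esym/(inf_unique below_complete) => [_ [x Xx <-]|Z ZX].
  by apply/restr_le/inf_lb.
apply/reg_leP => q Zq; apply/restrP/le_inf => // x Xx; apply/restrP.
by have /reg_leP := ZX (restr x) (ex_intro2 _ _ x Xx erefl); apply.
Qed.

Lemma restr_sup (X : set B) : restr (supremum \bot X) = supremum \bot (restr @` X).
Proof.
apply/esym/(sup_unique below_complete) => [_ [x Xx <-]|Z ZX].
  by apply/restr_le/sup_ub.
apply/reg_leP => q /restrP qX; rewrite -rsetP => r rZ.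
(* Each [x] in [X] is a point of [restr x], hence of [Z], so its meet with [r] vanishes below
   [b]. *)
have sr : supremum \bot X `&` (r `&` b) <= \bot.
  apply: supI_le => // x Xx; rewrite meetA; apply: (rZ x).
  have /reg_leP := ZX (restr x) (ex_intro2 _ _ x Xx erefl).
  by apply; apply/restrP; rewrite leIl.
apply: le_trans sr; rewrite lexI; apply/andP; split.
  by apply: le_trans qX; rewrite leI2// leIr.
by rewrite leI2// leIl.
Qed.

Lemma restr_beq_trans (x y z : M) :
  restr (beq x y) `&` restr (beq y z) <= restr (beq x z).
Proof. by rewrite -restrI restr_le// beq_trans. Qed.

Lemma restr_brel_subst (R : rsym L) (a a' : 'I_(arity R) -> M) :
  (\meet_(i < arity R) restr (beq (a i) (a' i))) `&` restr (brel a)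
    <= restr (brel a').
Proof.
rewrite -(big_morph restr restrI (restr1 (lex1 b))) -restrI restr_le//.
exact: brel_subst.
Qed.

Definition restr_model : bmodel L (reg below) := @BModel L _ (reg below) M
  (dom_inh M) (fun x y => restr (beq x y)) (fun R a => restr (brel a))
  (@bcst L d B M) (fun x => etrans (congr1 restr (beq_refl x)) (restr1 (lex1 b)))
  (fun x y => congr1 restr (beq_sym x y)) restr_beq_trans restr_brel_subst.

(** [restr] preserves complements and arbitrary suprema and infima, and these are all that the
    recursion for values uses. *)
Lemma restr_value (e : V -> M) p :
  value (M := restr_model) e p = restr (value e p).
Proof.
have tE (g : V -> M) t : teval (M := restr_model) g t = teval g t by case: t.
elim: p e => [t s|R a|q IH|K f IH|K f IH|W q IH|W q IH] e.
- by rewrite /= !tE.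
- by rewrite /=; congr (restr (brel _)); apply/funext => i; rewrite tE.
- by rewrite /= IH restrC.
- rewrite /= restr_inf image_comp/=; congr infimum; apply: eq_imagel => i _.
  exact: IH.
- rewrite /= restr_sup image_comp/=; congr supremum; apply: eq_imagel => i _.
  exact: IH.
- rewrite /= restr_inf image_comp/=; congr infimum; apply: eq_imagel => g _.
  exact: IH.
- rewrite /= restr_sup image_comp/=; congr supremum; apply: eq_imagel => g _.
  exact: IH.
Qed.

End Relativization.

(** Relativizing [M] to the value of [p] at [e] raises this value to [\top] and keeps the members of
    [T] at [\top]. *)
Lemma satisfiable_ex (L : signature) (V : choiceType) (T : set (formula L V))
    (d : Order.disp_t) (B : ctbDistrLatticeType d) (M : bmodel L B)
    (W : {fset V}) (p : formula L V) (e : V -> M) :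
  complete_boolean B -> models M T -> FV p `<=` [set` W] ->
  value e p != \bot%O -> boolean_satisfiable (T `|` [set Ex W p]).
Proof.
move=> cB MT pW e0; exists reg_display, (reg (below (value e p))).
exists (restr_model M (value e p)); split; first exact: below_complete e0.
apply/(modelsP (below_complete e0)) => g q [Tq|->].
  by rewrite (restr_value cB e0) ((modelsP cB M T).1 MT g q Tq) restr1// lex1.
rewrite (restr_value cB e0) restr1//; apply: value_ex_ge => // x /pW xW /negP.
by rewrite xW.
Qed.

(** * The completion of a Boolean valued model under mixtures *)

Section MixingCompletion.
Variables (L : signature) (V : choiceType).
Variables (d : Order.disp_t) (B : ctbDistrLatticeType d).
Hypothesis cB : complete_boolean B.
Variable M : bmodel L B.
Local Open Scope order_scope.

(* A mixture m of elements of M is represented by the function x |-> [m = x]. *)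
Record mixture := Mixture {
  mix_val :> M -> B;
  mix_single : forall x y, mix_val x `&` mix_val y <= beq x y;
  mix_ext : forall x y, mix_val x `&` beq x y <= mix_val y;
  mix_total : supremum \bot (range mix_val) = \top }.

Implicit Types (m : mixture) (x y : M) (a b c : B).

(** The values of a mixture cover [\top], so an inequality may be checked below each of them, where
    the mixture equals an element of [M]. *)
Lemma mix_cover m b c : (forall x, m x `&` b <= c) -> b <= c.
Proof.
move=> h; rewrite -[b]meet1x -(mix_total m); apply: supI_le => // _ [x _ <-].
exact: h.
Qed.

Definition mix_eq m m' : B := supremum \bot (range (fun x => m x `&` m' x)).

Lemma mix_eq_refl m : mix_eq m m = \top.
Proof.
apply/eqP; rewrite -le1x; apply: (mix_cover (m := m)) => x.
by rewrite meetx1; apply: sup_ub => //; exists x => //; rewrite meetxx.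
Qed.

Lemma mix_eq_sym m m' : mix_eq m m' = mix_eq m' m.
Proof.
by congr supremum; apply: eq_imagel => x _; rewrite meetC.
Qed.

Lemma mix_eq_val m m' x : mix_eq m m' `&` m x <= m' x.
Proof.
apply: supI_le => // _ [y _ <-]; apply: le_trans (mix_ext m' y x).
rewrite lexI [X in X && _]leIxl ?leIr//=; apply: le_trans (mix_single m y x).
by rewrite leI2// leIl.
Qed.

Lemma mix_eq_trans m1 m2 m3 : mix_eq m1 m2 `&` mix_eq m2 m3 <= mix_eq m1 m3.
Proof.
rewrite meetC; apply: supI_le => // _ [x _ <-].
apply: le_trans (_ : m1 x `&` m3 x <= _); last by apply: sup_ub => //; exists x.
rewrite lexI [X in _ && X]leIxl ?leIr// andbT.
rewrite mix_eq_sym meetC; apply: le_trans (mix_eq_val m2 m1 x).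
by rewrite leI2// leIl.
Qed.

(** An infimum of implications over the tuples of [M] lets the substitution inequality be proved one
    tuple at a time, without a covering argument. *)
Definition mix_rel (R : rsym L) (a : 'I_(arity R) -> mixture) : B :=
  infimum \top (range (fun k : 'I_(arity R) -> M =>
    ~` (\meet_(i < arity R) a i (k i)) `|` brel k)).

Lemma mix_rel_lb (R : rsym L) (a : 'I_(arity R) -> mixture) k :
  mix_rel a `&` \meet_(i < arity R) a i (k i) <= brel k.
Proof. by rewrite leI_compl; apply: inf_lb => //; exists k. Qed.

Lemma mix_rel_subst (R : rsym L) (a b : 'I_(arity R) -> mixture) :
  (\meet_(i < arity R) mix_eq (a i) (b i)) `&` mix_rel a <= mix_rel b.
Proof.
apply: le_inf => // _ [k _ <-]; rewrite -leI_compl.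
apply: le_trans (mix_rel_lb a k); rewrite lexI; apply/andP; split.
  by apply: leIxl; exact: leIr.
apply/meetsP => i _; apply: le_trans (mix_eq_val (b i) (a i) (k i)).
rewrite mix_eq_sym leI2//; last exact: meets_inf.
by apply: leIxl; exact: meets_inf.
Qed.

Lemma dirac_total x : supremum \bot (range (beq x)) = \top.
Proof.
by apply/eqP; rewrite -le1x -(beq_refl x); apply: sup_ub => //; exists x.
Qed.

Lemma dirac_single x y z : beq x y `&` beq x z <= beq y z.
Proof. by rewrite [beq x y]beq_sym; apply: beq_trans. Qed.

Definition dirac x : mixture :=
  Mixture (dirac_single x) (beq_trans x) (dirac_total x).

Lemma mix_inhabited : inhabited mixture.
Proof. by have [x] := dom_inh M; constructor; apply: dirac. Qed.

Definition mix_model : bmodel L B := @BModel L _ B mixture mix_inhabited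
  mix_eq mix_rel (fun s => dirac (bcst M s)) mix_eq_refl mix_eq_sym
  mix_eq_trans mix_rel_subst.

Lemma mix_eq_dirac m x : mix_eq m (dirac x) = m x.
Proof.
apply: (sup_unique cB) => [_ [y _ <-]|b h].
  by rewrite /= beq_sym; apply: mix_ext.
by apply: h; exists x => //=; rewrite beq_refl meetx1.
Qed.

Lemma mix_rel_dirac (R : rsym L) (k : 'I_(arity R) -> M) :
  mix_rel (fun i => dirac (k i)) = brel k.
Proof.
apply: (inf_unique cB) => [_ [k' _ <-]|b h].
  by rewrite -leI_compl meetC; apply: brel_subst.
apply: le_trans (h _ (ex_intro2 _ _ k I erefl)) _.
have -> : \meet_(i < arity R) dirac (k i) (k i) = \top.
  by rewrite big1//= => i _; rewrite beq_refl.
by rewrite compl1 join0x.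
Qed.

(** [mix_cover] is iterated along a finite list; without repetitions, the element chosen for one
    variable does not disturb the choices for the others. *)
Lemma mix_cover_env (g : V -> mixture) (ws : seq V) b c : uniq ws ->
  (forall k : V -> M, (\meet_(w <- ws) g w (k w)) `&` b <= c) -> b <= c.
Proof.
elim: ws => [|w ws IH]/= => [_ h|/andP[wws uws] h].
  by have [x] := dom_inh M; have := h (fun=> x); rewrite big_nil meet1x.
apply: IH => // k; apply: (mix_cover (m := g w)) => x; rewrite meetA.
have := h (fun z => if z == w then x else k z).
rewrite big_cons eqxx; congr (_ `&` _ `&` _ <= _).
by apply: eq_big_seq => z zws; case: eqP => // zw; rewrite -zw zws in wws.
Qed.

Lemma mix_cover_variants (g : V -> mixture) (e : V -> M) (W : {fset V}) b c :
  (forall v, v \notin W -> g v = dirac (e v)) ->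
  (forall (k : V -> M) a, variants e W k ->
     (forall v, a <= mix_eq (g v) (dirac (k v))) -> a `&` b <= c) ->
  b <= c.
Proof.
move=> ge h; apply: (mix_cover_env (g := g) (fset_uniq W)) => k.
apply: (h _ _ (@override_variant _ _ _ _ M W e k)) => x.
rewrite /override; case: ifPn => xW /=.
  by rewrite mix_eq_dirac; apply: meets_inf_seq.
by rewrite ge// mix_eq_refl lex1.
Qed.

(** Only quantifiers need care, since they now range over mixtures. A quantifier binds finitely many
    variables, so by [mix_cover_variants] an assignment of mixtures agrees with assignments of
    elements on Boolean values that cover [\top], and [value_congr] compares the values there. *)
Lemma mix_value (e : V -> M) (p : formula L V) :
  value (M := mix_model) (dirac \o e) p = value e p.
Proof.
have tE (k : V -> M) t :
    teval (M := mix_model) (dirac \o k) t = dirac (teval k t) by case: t.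
elim: p e => [t s|R a|q IH|K f IH|K f IH|W q IH|W q IH] e.
- by rewrite /= !tE mix_eq_dirac.
- by rewrite /= -mix_rel_dirac; congr mix_rel; apply/funext => i; rewrite tE.
- by rewrite /= IH.
- by rewrite /=; congr infimum; apply: eq_imagel => i _; apply: IH.
- by rewrite /=; congr supremum; apply: eq_imagel => i _; apply: IH.
- rewrite /=; apply: (inf_unique cB) => [_ [g ge <-]|b h]; last first.
    apply: le_inf => // _ [k ke <-]; rewrite -IH; apply: h.
    by exists (dirac \o k) => // x xW /=; rewrite ke.
  apply: mix_cover_variants ge _ => k a ke ak.
  apply: le_trans (_ : a `&` value (M := mix_model) (dirac \o k) q <= _).
    by rewrite IH leI2//; apply: inf_lb => //; exists k.
  by apply: (value_congr cB) => x _; rewrite /= mix_eq_sym.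
- rewrite /=; apply: (sup_unique cB) => [_ [g ge <-]|b h]; last first.
    apply: sup_le => // _ [k ke <-]; rewrite -IH; apply: h.
    by exists (dirac \o k) => // x xW /=; rewrite ke.
  apply: mix_cover_variants ge _ => k a ke ak.
  apply: le_trans (value_congr cB (M := mix_model) (e' := dirac \o k) _) _.
    by move=> x _; apply: ak.
  by rewrite IH; apply: sup_ub => //; exists k.
Qed.

Section Gluing.
Variable P : set (B * mixture).
Hypothesis P_compat : forall u w, P u -> P w -> forall x y,
  (u.1 `&` u.2 x) `&` (w.1 `&` w.2 y) <= beq x y.
Hypothesis P_cover : supremum \bot [set u.1 | u in P] = \top.

Definition glue_val x : B := supremum \bot [set u.1 `&` u.2 x | u in P].

Lemma glue_single x y : glue_val x `&` glue_val y <= beq x y.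
Proof.
apply: supI_le => // _ [u Pu <-]; rewrite meetC.
by apply: supI_le => // _ [w Pw <-]; rewrite meetC; apply: P_compat.
Qed.

Lemma glue_ext x y : glue_val x `&` beq x y <= glue_val y.
Proof.
apply: supI_le => // _ [u Pu <-].
apply: le_trans (_ : u.1 `&` u.2 y <= _); last by apply: sup_ub => //; exists u.
by rewrite -meetA leI2// mix_ext.
Qed.

Lemma glue_total : supremum \bot (range glue_val) = \top.
Proof.
apply/eqP; rewrite -le1x -P_cover; apply: sup_le => // _ [u Pu <-].
apply: (mix_cover (m := u.2)) => x.
apply: le_trans (_ : glue_val x <= _); last by apply: sup_ub => //; exists x.
by apply: sup_ub => //; exists u => //; rewrite meetC.
Qed.

Definition glue : mixture := Mixture glue_single glue_ext glue_total.

Lemma glue_eq u : P u -> u.1 <= mix_eq glue u.2.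
Proof.
move=> Pu; apply: (mix_cover (m := u.2)) => x.
apply: le_trans (_ : glue_val x `&` u.2 x <= _).
  by rewrite lexI leIl andbT; apply: sup_ub => //; exists u => //; rewrite meetC.
by apply: sup_ub => //; exists x.
Qed.

End Gluing.

Lemma mix_model_mixing : mixing mix_model.
Proof.
move=> X X_anti tau; have [m0] := mix_inhabited.
(* The antichain need not cover [\top], so the complement of its supremum is added with an arbitrary
   mixture [m0]. *)
pose P : set (B * mixture) := [set u | (X u.1 /\ u.2 = tau u.1) \/
  (u.1 = ~` supremum \bot X /\ u.2 = m0)].
have XC a : X a -> a `&` ~` supremum \bot X = \bot.
  move=> Xa; apply/eqP; rewrite disj_leC complK; exact: sup_ub.
have P_compat u w : P u -> P w -> forall x y,
    (u.1 `&` u.2 x) `&` (w.1 `&` w.2 y) <= beq x y.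
  move=> Pu Pw x y; rewrite meetACA.
  (* Two pairs share their mixture, where [mix_single] applies, or have disjoint weights. *)
  have [->|] : u.2 = w.2 \/ u.1 `&` w.1 = \bot; last 1 first.
  - by move=> ->; rewrite meet0x.
  - case: Pu Pw => -[u1 ->] [] [w1 ->]; last by left.
    + have [->|uw] := pselect (u.1 = w.1); [by left|].
      by right; apply: X_anti.
    + by right; rewrite w1; apply: XC.
    + by right; rewrite u1 meetC; apply: XC.
  - by apply: leIxr; apply: mix_single.
have P_cover : supremum \bot [set u.1 | u in P] = \top.
  apply/eqP; rewrite -le1x -(joinxC (supremum \bot X)) leUx; apply/andP; split.
    apply: sup_le => // a Xa; apply: sup_ub => //; exists (a, tau a) => //.
    by left.
  by apply: sup_ub => //; exists (~` supremum \bot X, m0) => //; right.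
exists (glue P_compat P_cover) => a Xa.
by apply: (glue_eq P_compat P_cover (u := (a, tau a))); left.
Qed.

End MixingCompletion.

(** * Instances of formulae inside a fragment *)

Section FragmentInstances.
Variables (L : signature) (V : choiceType) (v : nat -> V).
Hypothesis v_inj : injective v.
Variable A : set (formula L V).
Hypotheses (A_frag : fragment A) (A_eq : var_equalities v `<=` A).
Implicit Types (p q : formula L V) (t : term L V) (x y : V) (xs : seq V).

Lemma FV_occurs p : FV p `<=` occurs p.
Proof.
elim: p => //= [t s|R a|K f IH|K f IH|W q IH|W q IH] x //.
- by move=> [i _ xi]; exists i => //; apply: IH.
- by move=> [i _ xi]; exists i => //; apply: IH.
- by move=> [/IH ? _]; left.
- by move=> [/IH ? _]; left.
Qed.

Lemma occurs_in_FV p : A p -> FV p `<=` occurs_in A.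
Proof. by move=> Ap x /FV_occurs xp; exists p. Qed.

Lemma occurs_in_var i : occurs_in A (v i).
Proof. by exists (Eq (Var L (v i)) (Var L (v i))); [apply: A_eq; exists i, i|left]. Qed.

(** The equation arises from a generator by substituting for one variable after the other. *)
Lemma fragment_Eq t s : tvar t `<=` occurs_in A -> tvar s `<=` occurs_in A ->
  A (Eq t s).
Proof.
move=> tA sA.
(* The variable replaced second must not occur in the term put in first. *)
have [k [l [kl lt]]] : exists k l, v l <> v k /\ ~ tvar t (v l).
  have [t0|] := pselect (tvar t (v 0)); last by exists 1, 0; split => // /v_inj.
  exists 0, 1; split => [/v_inj//|].
  by case: (t) t0 => //= x <- /v_inj.
have /(frag_subst A_frag (x := v k) (t := t)) : A (Eq (Var L (v k)) (Var L (v l))).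
  by apply: A_eq; exists k, l.
move=> /(_ tA I) /(frag_subst A_frag (x := v l) (t := s)) /(_ sA I) /=.
rewrite eqxx; have /eqP/negbTE -> := kl; rewrite /= eqxx.
suff -> : tsubst (v l) s t = t by [].
by case: (t) lt => //= x xl; case: eqP => // xl'; case: xl; rewrite xl'.
Qed.

(** Substitution could capture a variable of [t]; the formula stating that some [x] equals [t] and
    satisfies [p] has the required value without that risk. If [t] is [x], or if [x] is not free in
    [p], then [p] itself serves. *)
Lemma fragment_subst1 p x t : A p -> tvar t `<=` occurs_in A ->
  exists q, [/\ A q, FV q `<=` (FV p `\ x) `|` tvar t
    & forall d (B : ctbDistrLatticeType d) (M : bmodel L B) (e : V -> M),
        complete_boolean B ->
        value e q = value (fun y => if y == x then teval e t else e y) p].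
Proof.
move=> Ap tA.
have [xp|xp] := pselect (FV p x); last first.
  exists p; split=> // [y yp|d B M e cB]; first by left; split => // yx; case: xp; rewrite -yx.
  by apply: value_eq => // y yp; case: eqP => // yx; case: xp; rewrite -yx.
have [tx|tx] := pselect (tvar t x).
  have -> : t = Var L x by case: (t) tx => // y /= ->.
  exists p; split=> // [y yp|d B M e cB]; last first.
    by apply: value_eq => // y yp /=; case: eqP => // ->.
  by have [->|yx] := pselect (y = x); [right|left].
have xA : occurs_in A x by apply: occurs_in_FV xp.
exists (Ex [fset x]%fset (and2 (Eq (Var L x) t) p)); split.
- apply: (frag_ex A_frag) => //; apply: (frag_and A_frag) => //.
  by apply: fragment_Eq => // y ->.
- move=> y [[[] _ /=]]; last by move=> yp yx; left; split => // yx'; apply: yx; rewrite /= yx' inE.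
  by move=> [->|yt _]; [rewrite inE eqxx|right].
move=> d B M e cB; set e' := fun y => _.
have tE (g : V -> M) : variants e [fset x]%fset g -> teval g t = teval e t.
  case: (t) tx => //= y yx -> //; rewrite inE; apply/eqP => yx'; exact: yx.
rewrite -[LHS]/(supremum _ [set value g (and2 _ _) | g in variants e _]).
apply: (sup_unique cB) => [_ [g ge <-]|b].
  rewrite value_and2//= tE//; apply: value_congr => // y _.
  rewrite /e'; case: eqP => [->//|/eqP yx].
  by rewrite (ge y) ?beq_refl ?lex1 ?in_fset1.
have e'v : variants e [fset x]%fset e'.
  by move=> y; rewrite in_fset1 /e' => /negbTE ->.
move=> /(_ _ (ex_intro2 _ _ e' e'v erefl)).
by rewrite value_and2//= tE// /e' eqxx beq_refl meet1x.
Qed.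

(** As no variable of [xs] occurs in the terms put in, substituting one variable at a time amounts
    to substituting simultaneously. *)
Lemma fragment_subst_seq p xs (f : V -> term L V) : A p ->
  (forall x, x \in xs -> tvar (f x) `<=` occurs_in A) ->
  (forall x y, x \in xs -> y \in xs -> ~ tvar (f x) y) ->
  exists q, [/\ A q,
      (forall y, FV q y ->
         (FV p y /\ y \notin xs) \/ exists2 x, x \in xs & tvar (f x) y)
    & forall d (B : ctbDistrLatticeType d) (M : bmodel L B) (e : V -> M),
        complete_boolean B ->
        value e q = value (fun y => if y \in xs then teval e (f y) else e y) p].
Proof.
move=> Ap; elim: xs => [|x xs IH] fA fx.
  by exists p; split=> // y yp; left.
have sub y : y \in xs -> y \in x :: xs by rewrite inE => ->; rewrite orbT.
have [q1 [Aq1 FVq1 vq1]] :=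
  IH (fun y yxs => fA y (sub y yxs)) (fun y z yxs zxs => fx y z (sub y yxs) (sub z zxs)).
have [q [Aq FVq vq]] := fragment_subst1 x Aq1 (fA x (mem_head _ _)).
exists q; split=> // [y /FVq[[/FVq1 [[py yxs]|[z zxs zy]] yx]|yx]|d B M e cB].
- by left; split=> //; rewrite inE negb_or yxs andbT; apply/eqP.
- by right; exists z => //; rewrite inE zxs orbT.
- by right; exists x => //; rewrite mem_head.
rewrite vq// vq1//; apply: value_eq => // y py; rewrite inE.
case: (boolP (y \in xs)) => yxs; rewrite ?orbT ?orbF; last by case: eqP => // ->.
have := fx y x; rewrite !inE yxs orbT eqxx => /(_ isT isT).
by case: (f y) => //= z zx; case: eqP => // zx'; case: zx; rewrite zx'.
Qed.

Lemma var_fresh (xs : seq V) : exists N, forall l, v (N + l) \notin xs.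
Proof.
elim: xs => [|x xs [N NP]]; first by exists 0.
have [[k xk]|nk] := pselect (exists k, x = v k).
  (* The new bound must exceed the index [k] as well as respect [N]. *)
  exists (N + k.+1) => l; rewrite inE negb_or -addnA NP andbT xk.
  apply/eqP => /v_inj/eqP; rewrite gtn_eqF//.
  exact: leq_trans (leq_addr l k.+1) (leq_addl N _).
exists N => l; rewrite inE negb_or NP andbT; apply/eqP => xl.
by apply: nk; exists (N + l).
Qed.

Definition tvar_seq t : seq V := if t is Var x then [:: x] else [::].

Lemma tvar_seqP t x : tvar t x <-> x \in tvar_seq t.
Proof. by case: t => [y|c] //=; rewrite inE; split=> /eqP. Qed.

(* Renaming to fresh variables first turns a simultaneous substitution into a
   sequence of substitutions of a single variable. *)
Lemma fragment_instance p (f : V -> term L V) : A p ->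
  (forall x, FV p x -> tvar (f x) `<=` range v) ->
  exists q, [/\ A q, FV q `<=` \bigcup_(x in FV p) tvar (f x)
    & forall d (B : ctbDistrLatticeType d) (M : bmodel L B) (e : V -> M),
        complete_boolean B -> value e q = value (fun x => teval e (f x)) p].
Proof.
move=> Ap fv.
have /finite_seqP [xs pxs] : finite_set (FV p).
  exact/Linf_FV_finite/(frag_Linf A_frag).
have [N NP] := var_fresh (xs ++ flatten [seq tvar_seq (f x) | x <- xs]).
pose r x := v (N + index x xs).
have r_inj x y : x \in xs -> y \in xs -> r x = r y -> x = y.
  move=> xx yx /v_inj/addnI ixy.
  by rewrite -(nth_index (v 0) xx) ixy nth_index.
have r_fresh x : r x \notin xs.
  by have := NP (index x xs); rewrite mem_cat negb_or => /andP[].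
have r_freshf x y : x \in xs -> ~ tvar (f x) (r y).
  move=> xx /tvar_seqP xy; have := NP (index y xs).
  rewrite mem_cat negb_or => /andP[_ /negP]; apply.
  by apply/flattenP; exists (tvar_seq (f x)) => //; apply: map_f.
have [q1 [Aq1 FVq1 vq1]] := @fragment_subst_seq p xs (fun x => Var L (r x)) Ap
  (fun x _ y yr => eq_ind_r (occurs_in A) (occurs_in_var _) yr)
  (fun x y _ yx yr => negP (r_fresh x) (eq_ind y (fun z => z \in xs) yx _ yr)).
pose ys := map r xs; pose r' y := nth (v 0) xs (index y ys).
have rK x : x \in xs -> r' (r x) = x.
  move=> xx; have rx : r x \in ys by apply: map_f.
  have ix : index (r x) ys < size xs by rewrite -(size_map r) index_mem.
  apply: r_inj => //; first by rewrite mem_nth.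
  by rewrite /r' -(nth_map _ (v 0))// nth_index.
have rK' y : y \in ys -> exists2 x, x \in xs & y = r x by move=> /mapP.
have [||q2 [Aq2 FVq2 vq2]] := @fragment_subst_seq q1 ys (fun y => f (r' y)) Aq1.
- move=> _ /rK'[x xx ->]; rewrite rK// => z /fv; rewrite pxs => /(_ xx)[i _ <-].
  exact: occurs_in_var.
- by move=> _ _ /rK'[x xx ->] /rK'[y yx ->]; rewrite rK//; apply: r_freshf.
exists q2; split=> // [y /FVq2[[/FVq1 q1y /negP yys]|[_ /rK'[x xx ->]]]|d B M e cB].
- case: q1y => [[]|[x xx yr]]; first by rewrite pxs /= => ->.
  by case: yys; rewrite yr; apply: map_f.
- by rewrite rK// => xy; exists x => //; rewrite pxs.
rewrite vq2// vq1//; apply: value_eq => // x; rewrite pxs/= => xx.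
by rewrite xx map_f// rK.
Qed.

End FragmentInstances.

(** * Membership in infima and suprema of regular sets *)

Section RegularSetsComplete.
Variable P : phase_space.
Hypothesis P_nontrivial : exists p : P, ~ null p.
Let cP := reg_complete P_nontrivial.
Local Open Scope order_scope.

Lemma reg_infP (S : set (reg P)) q :
  rset (infimum \top S) q <-> forall X, S X -> rset X q.
Proof.
split=> [qS X SX|qS]; first by have /reg_leP := inf_lb cP SX; apply.
(* This is the intersection of the members of [S], written as a polar so that it is regular. *)
pose Y := Reg (perpKK (\bigcup_(X in S) perp (rset X))).
have /reg_leP : Y <= infimum \top S; last first.
  by apply=> p [X SX Xp]; apply/nullC/Xp/qS.
apply: le_inf => // X SX; apply/reg_leP => r; rewrite /= -[rset X]rsetP.
by apply: perpS => p Xp; exists X.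
Qed.

Lemma reg_supP (S : set (reg P)) q : rset (supremum \bot S) q <->
  forall r, (forall X, S X -> perp (rset X) r) -> null (mul r q).
Proof.
have -> : supremum \bot S = close (\bigcup_(X in S) rset X).
  apply: (sup_unique cP) => [X SX|Y SY].
    by apply/reg_leP => p Xp; apply: sub_perpK; exists X.
  by apply/reg_leP/closeP => p [X /SY/reg_leP]; apply.
split=> h r rS; apply: h; first by move=> p [X SX Xp]; apply: rS SX _ _.
by move=> X SX p Xp; apply: rS; exists X.
Qed.

End RegularSetsComplete.

(** * The model of names over the algebra of conditions *)

Section GenericModel.
Variables (L : signature) (V : choiceType) (v : nat -> V).
Hypothesis v_inj : injective v.
Variables (T A : set (formula L V)).
Hypotheses (A_frag : fragment A) (A_eq : var_equalities v `<=` A).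
Hypothesis T_sat : boolean_satisfiable T.
Local Open Scope order_scope.

(* The natural numbers are names of elements of a model of T that is not yet
   determined. *)
Notation name := (term L nat).

Record statement := Statement {
  st_formula : formula L V;
  st_names : V -> name;
  st_fragment : A st_formula }.

Definition condition := seq statement.

(** Valuations replace formulae so that relations between names have a meaning even when the atomic
    formula is not in [A]. *)
Definition valuation := forall (d : Order.disp_t) (B : ctbDistrLatticeType d)
  (M : bmodel L B), (nat -> M) -> B.

Definition inst_value (s : V -> name) (p : formula L V) : valuation :=
  fun d B M e => value (fun x => teval e (s x)) p.

Definition st_value (c : statement) : valuation :=
  inst_value (st_names c) (st_formula c).

Definition cond_value (q : condition) : valuation :=
  fun d B M e => \meet_(c <- q) st_value c e.

Definition entails (q : condition) (F : valuation) : Prop :=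
  forall d (B : ctbDistrLatticeType d) (M : bmodel L B), complete_boolean B ->
    models M T -> forall e : nat -> M, cond_value q e <= F d B M e.

Definition inconsistent (q : condition) : Prop := entails q (fun d B M e => \bot).

Lemma cond_value_cat q r d (B : ctbDistrLatticeType d) (M : bmodel L B)
  (e : nat -> M) : cond_value (q ++ r) e = cond_value q e `&` cond_value r e.
Proof. exact: big_cat. Qed.

Lemma cond_value1 c d (B : ctbDistrLatticeType d) (M : bmodel L B)
  (e : nat -> M) : cond_value [:: c] e = st_value c e.
Proof. exact: big_seq1. Qed.

Lemma inconsistentC p q : inconsistent (p ++ q) -> inconsistent (q ++ p).
Proof.
by move=> h d B M cB MT e; have := h d B M cB MT e; rewrite !cond_value_cat meetC.
Qed.
Lemma inconsistentK p : inconsistent (p ++ p) -> inconsistent p.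
Proof.
by move=> h d B M cB MT e; have := h d B M cB MT e; rewrite !cond_value_cat meetxx.
Qed.
Lemma inconsistentW p q : inconsistent p -> inconsistent (p ++ q).
Proof.
move=> h d B M cB MT e; have := h d B M cB MT e; rewrite !cond_value_cat.
by apply: le_trans; rewrite leIl.
Qed.
Lemma inconsistentA p q r :
  inconsistent ((p ++ q) ++ r) <-> inconsistent (p ++ (q ++ r)).
Proof. by rewrite catA. Qed.
Lemma inconsistentKK p r : inconsistent (p ++ (p ++ r)) -> inconsistent (p ++ r).
Proof.
move=> h d B M cB MT e; have := h d B M cB MT e.
by rewrite !cond_value_cat meetA meetxx.
Qed.

Definition conditions : phase_space := PhaseSpace inconsistentC inconsistentK
  inconsistentW inconsistentA inconsistentKK.

Lemma conditions_nontrivial : exists q : conditions, ~ null q.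
Proof.
have [d [B [M [cB MT]]]] := T_sat; exists [::] => /= h.
have [x] := dom_inh M; have := h d B M cB MT (fun=> x).
by rewrite /cond_value big_nil lex0 eq_sym; apply/negP; case: cB.
Qed.

(** For a statement the closure adds nothing, by [force_st]; it ensures regularity for an arbitrary
    valuation. *)
Definition force (F : valuation) : reg conditions :=
  close (P := conditions) [set q | entails q F].

Lemma entails_force F (q : condition) : entails q F -> rset (force F) q.
Proof. exact: (sub_perpK (P := conditions)). Qed.

Definition st_not (c : statement) : statement :=
  Statement (st_names c) (frag_not A_frag (st_fragment c)).

Lemma st_notP q c : inconsistent (st_not c :: q) <-> entails q (st_value c).
Proof.
have E d (B : ctbDistrLatticeType d) (M : bmodel L B) (e : nat -> M) :
    (cond_value (st_not c :: q) e <= \bot) = (cond_value q e <= st_value c e).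
  by rewrite /cond_value big_cons meetC leI_compl complK joinx0.
by split=> h d B M cB MT e; move: (h d B M cB MT e); rewrite E.
Qed.

(** The negation of [c] is again a statement and is incompatible with every condition that entails
    [c]. A condition in the double polar is therefore incompatible with this negation, that is, it
    entails [c]. *)
Lemma force_st c (q : condition) : rset (force (st_value c)) q <-> entails q (st_value c).
Proof.
split; last exact: entails_force.
move=> /(_ [:: st_not c]) h; apply/st_notP/h => p /st_notP.
exact: (inconsistentC (p := [:: _])).
Qed.

(** This gives the substitution inequality for relations, where [force] need not reduce to
    entailment. If [p] entails [G], then [p ++ q] entails [H], and the second occurrence of [q] is
    absorbed by [inconsistentKK]. *)
Lemma force_combine (F G H : valuation) (q : condition) :
  (forall d (B : ctbDistrLatticeType d) (M : bmodel L B) e,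
     F d B M e `&` G d B M e <= H d B M e) ->
  entails q F -> rset (force G) q -> rset (force H) q.
Proof.
move=> FGH qF qG r rH; apply/inconsistentC/inconsistentKK/inconsistentC/qG => p pG.
apply/inconsistentA/(rH (p ++ q)) => d B M cB MT e; rewrite cond_value_cat meetC.
by apply: le_trans (FGH d B M e); rewrite leI2//; [apply: qF|apply: pG].
Qed.

(** Since [v 0 = v 1] is a generator, equality of any two names is a statement about the
    fragment. *)
Definition eq_statement (t u : name) : statement := Statement
  (fun x => if x == v 0 then t else u)
  (A_eq (ex_intro _ 0 (ex_intro _ 1 (erefl (Eq (Var L (v 0)) (Var L (v 1))))))).

Definition name_eq_value (t u : name) : valuation :=
  fun d B M e => beq (teval e t) (teval e u).

Lemma eq_statementE t u : st_value (eq_statement t u) = name_eq_value t u.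
Proof.
rewrite /st_value /inst_value /name_eq_value /= eqxx.
by have -> : (v 1 == v 0) = false by apply/eqP => /v_inj.
Qed.

Definition name_eq (t u : name) := force (name_eq_value t u).

Lemma name_eqP t u (q : condition) :
  rset (name_eq t u) q <-> entails q (name_eq_value t u).
Proof. by rewrite /name_eq -eq_statementE; apply: force_st. Qed.

Definition name_rel_value (R : rsym L) (a : 'I_(arity R) -> name) : valuation :=
  fun d B M e => brel (fun i => teval e (a i)).

Definition name_rel (R : rsym L) (a : 'I_(arity R) -> name) :=
  force (name_rel_value a).

Lemma name_eq_refl t : name_eq t t = \top.
Proof.
by apply/reg_topP => q; apply/name_eqP => d B M cB MT e; rewrite /name_eq_value beq_refl lex1.
Qed.

Lemma name_eq_sym t u : name_eq t u = name_eq u t.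
Proof.
by apply/reg_eq/seteqP; split=> q /name_eqP h; apply/name_eqP => d B M cB MT e;
  have := h d B M cB MT e; rewrite /name_eq_value beq_sym.
Qed.

Lemma name_eq_trans t u w : name_eq t u `&` name_eq u w <= name_eq t w.
Proof.
apply/reg_leP => q [/name_eqP h1 /name_eqP h2]; apply/name_eqP => d B M cB MT e.
by apply: le_trans (beq_trans _ (teval e u) _); rewrite lexI h1 ?h2.
Qed.

Lemma name_rel_subst (R : rsym L) (a b : 'I_(arity R) -> name) :
  (\meet_(i < arity R) name_eq (a i) (b i)) `&` name_rel a <= name_rel b.
Proof.
apply/reg_leP => q [/= qE]; apply: (force_combine
  (F := fun d B M e => \meet_(i < arity R) beq (teval e (a i)) (teval e (b i)))).
  by move=> d B M e; apply: brel_subst.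
move=> d B M cB MT e; apply/meetsP => i _.
suff /name_eqP : rset (name_eq (a i) (b i)) q by apply.
by have /reg_leP : \meet_(i < arity R) name_eq (a i) (b i) <= name_eq (a i) (b i);
  [apply: meets_inf|apply].
Qed.

Definition generic_model : bmodel L (reg conditions) := @BModel L _ _ name
  (inhabits (Var L 0)) name_eq name_rel (@Cst L nat) name_eq_refl name_eq_sym
  name_eq_trans name_rel_subst.

Lemma teval_agree (t : name) d (B : ctbDistrLatticeType d) (M : bmodel L B)
    (e e' : nat -> M) : (forall k, tvar t k -> e k = e' k) -> teval e t = teval e' t.
Proof. by case: t => //= k; apply. Qed.

Lemma names_bounded (p : formula L V) (s : V -> name) : Linf p ->
  exists N, forall x k, FV p x -> tvar (s x) k -> (k < N)%N.
Proof.
move=> /Linf_FV_finite/finite_seqP[xs ->].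
exists (\max_(x <- xs) (if s x is Var k then k.+1 else 0))%N => x k /= xx sk.
apply: leq_trans (leq_bigmax_seq _ xx isT).
by case: (s x) sk => //= l ->.
Qed.

Lemma cond_value_support (q : condition) :
  exists N, forall d (B : ctbDistrLatticeType d) (M : bmodel L B) (e e' : nat -> M),
    complete_boolean B ->
    (forall k, (k < N)%N -> e k = e' k) -> cond_value q e = cond_value q e'.
Proof.
elim: q => [|c q [N NP]].
  by exists 0%N => d B M e e' cB _; rewrite /cond_value !big_nil.
have [K KP] := names_bounded (st_names c) (frag_Linf A_frag (st_fragment c)).
exists (maxn N K) => d B M e e' cB ee'; rewrite -cat1s !cond_value_cat !cond_value1.
congr (_ `&` _).
  apply: value_eq => // x xc; apply: teval_agree => k xk.
  by apply: ee'; rewrite leq_max (KP x k) ?orbT.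
by apply: NP => // k kN; apply: ee'; rewrite leq_max kN.
Qed.

(** The variables in [W] receive names beyond all those in [q] and in the instance of [p]. One such
    choice serves all models and all variants [g], because the fresh names can be reinterpreted
    without changing the value of [q]. *)
Lemma fresh_names (q : condition) (p : formula L V) (s : V -> name) (W : {fset V}) : Linf p ->
  exists2 s' : V -> name, (forall x, x \notin W -> s' x = s x) &
    forall d (B : ctbDistrLatticeType d) (M : bmodel L B) (e : nat -> M) (g : V -> M),
      complete_boolean B -> variants (fun x => teval e (s x)) W g ->
      exists2 e' : nat -> M, cond_value q e' = cond_value q e
        & inst_value s' p e' = value g p.
Proof.
move=> /(names_bounded s)[K KP]; have [N NP] := cond_value_support q.
pose m := maxn N K; pose ws : seq V := enum_fset W.
exists (fun x => if x \in W then Var L (m + index x ws)%N else s x).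
  by move=> x /negbTE ->.
move=> d B M e g cB ge.
pose e' k := if (k < m)%N then e k else g (nth (v 0) ws (k - m)).
exists e'.
  by apply: NP => // k kN; rewrite /e' leq_max kN.
apply: value_eq => // x xp /=; case: ifPn => xW /=.
  by rewrite /e' ltnNge leq_addr/= addKn nth_index.
rewrite ge//; apply: teval_agree => k xk.
by rewrite /e' leq_max (KP x k) ?orbT.
Qed.

Lemma teval_generic (e : V -> generic_model) t d (B : ctbDistrLatticeType d)
    (M : bmodel L B) (k : nat -> M) :
  teval k (teval e t) = teval (fun x => teval k (e x)) t.
Proof. by case: t. Qed.

Lemma entails_st_self c : entails [:: c] (st_value c).
Proof. by move=> d B M cB MT e; rewrite cond_value1. Qed.

Lemma entails_value_perp (p : formula L V) (pA : A p) s (r : condition) :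
  perp (P := conditions) [set q | entails q (inst_value s p)] r ->
  inconsistent (Statement s pA :: r).
Proof.
by move=> h; apply: (h [:: Statement s pA]); apply: (entails_st_self (Statement s pA)).
Qed.

(** The truth lemma of forcing. Closure of [A] under negation turns membership in a supremum into
    entailment, and fresh names pass from instances at names to arbitrary elements of arbitrary
    models. *)
Lemma generic_truth p : A p -> forall (s : V -> generic_model) (q : condition),
  rset (value s p) q <-> entails q (inst_value s p).
Proof.
elim: p => [t u|R a|p IH|K f IH|K f IH|W p IH|W p IH] pA s q.
- apply: (iff_trans (name_eqP (teval s t) (teval s u) q)); split=> h d B M cB MT e; have := h d B M cB MT e;
  by rewrite /name_eq_value /inst_value /= !teval_generic.
- pose c := Statement s pA.
  have cE : st_value c = name_rel_value (fun i => teval s (a i) : name).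
    rewrite /st_value /inst_value /name_rel_value.
    apply: functional_extensionality_dep => d.
    apply: functional_extensionality_dep => B.
    apply: functional_extensionality_dep => M.
    apply: functional_extensionality_dep => e /=.
    by congr brel; apply/funext => i; rewrite teval_generic.
  by apply: (iff_trans _ (force_st c q)); rewrite cE.
- have pA' : A p by apply: (frag_sub A_frag pA).
  pose c := Statement s pA'.
  rewrite [rset _ _]/=; split=> [h|h r /(IH pA') rp].
    move: (h [:: c]); rewrite IH// => /(_ (@entails_st_self c)) cq d B M cB MT e.
    have := cq d B M cB MT e; rewrite /= -cat1s cond_value_cat cond_value1.
    by rewrite lex0 meetC disj_leC.
  move=> d B M cB MT e; rewrite cond_value_cat meetC leI_compl joinx0.
  by apply: le_trans (h d B M cB MT e) _; rewrite leC; apply: rp.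
- have fA i : A (f i) by apply: (frag_sub A_frag pA); exists i.
  apply: (iff_trans (reg_infP conditions_nontrivial _ q)); split=> h.
    move=> d B M cB MT e; apply: le_inf => // _ [i _ <-].
    by apply: ((IH i (fA i) s q).1 _ d B M cB MT e); apply: h; exists i.
  move=> _ [i _ <-]; apply/(IH i (fA i)) => d B M cB MT e.
  by apply: le_trans (h d B M cB MT e) _; apply: inf_lb => //; exists i.
- have fA i : A (f i) by apply: (frag_sub A_frag pA); exists i.
  apply: (iff_trans (reg_supP conditions_nontrivial _ q)); split=> h.
    apply/(st_notP q (Statement s pA))/(h [:: st_not (Statement s pA)]).
    move=> _ [i _ <-] r /(IH i (fA i)) ri; apply/(inconsistentC (p := [:: _]))/st_notP.
    move=> d B M cB MT e; apply: le_trans (ri d B M cB MT e) _.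
    by apply: sup_ub => //; exists i.
  move=> r rX d B M cB MT e; rewrite cond_value_cat meetC.
  apply: le_trans (leI2 (h d B M cB MT e) (lexx _)) _.
  apply: supI_le => // _ [i _ <-].
  have /entails_value_perp : perp (P := conditions)
      [set q | entails q (inst_value s (f i))] r.
    by move=> r' /(IH i (fA i)); apply: rX; exists i.
  move=> /(_ (fA i) d B M cB MT e); rewrite -cat1s cond_value_cat cond_value1.
  exact.
- have pA' : A p by apply: (frag_sub A_frag pA).
  apply: (iff_trans (reg_infP conditions_nontrivial _ q)); split=> h.
    (* The single instance at fresh names already yields the universal statement. *)
    have [s' s's fresh] := fresh_names q s W (frag_Linf A_frag pA').
    move=> d B M cB MT e; apply: le_inf => // _ [g ge <-].
    have [e' <- ge'] := fresh d B M e g cB ge.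
    rewrite -[X in _ <= X]/(value g p) -ge'.
    by apply: ((IH pA' s' q).1 _ d B M cB MT e'); apply: h; exists s'.
  move=> _ [s' s's <-]; apply/(IH pA') => d B M cB MT e.
  apply: le_trans (h d B M cB MT e) _; apply: inf_lb => //.
  by exists (fun x => teval e (s' x)) => // x xW; rewrite s's.
- have pA' : A p by apply: (frag_sub A_frag pA).
  apply: (iff_trans (reg_supP conditions_nontrivial _ q)); split=> h.
    apply/(st_notP q (Statement s pA))/(h [:: st_not (Statement s pA)]).
    move=> _ [s' s's <-] r /(IH pA') ri; apply/(inconsistentC (p := [:: _]))/st_notP.
    move=> d B M cB MT e; apply: le_trans (ri d B M cB MT e) _.
    apply: sup_ub => //.
    by exists (fun x => teval e (s' x)) => // x xW; rewrite s's.
  move=> r rX d B M cB MT e; rewrite cond_value_cat meetC.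
  apply: le_trans (leI2 (h d B M cB MT e) (lexx _)) _.
  apply: supI_le => // _ [g ge <-].
  (* Here freshness is relative to [r]: being incompatible with the instance at fresh names, [r] is
     incompatible with a witness [g] in any model. *)
  have [s' s's fresh] := fresh_names r s W (frag_Linf A_frag pA').
  have [e' <- ge'] := fresh d B M e g cB ge.
  rewrite -[X in X `&` _]/(value g p) -ge'.
  have /entails_value_perp : perp (P := conditions)
      [set q | entails q (inst_value s' p)] r.
    by move=> r' /(IH pA'); apply: rX; exists s'.
  move=> /(_ pA' d B M cB MT e'); rewrite -cat1s cond_value_cat cond_value1.
  exact.
Qed.

(** * Conditions expressed by formulae of the fragment, and density *)

(* The element named k is denoted by the variable v (n + k), which leaves the
   variables v 0, ..., v (n - 1) for a tuple of elements. *)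
Definition name_term (n : nat) (t : name) : term L V :=
  match t with Var k => Var L (v (n + k)) | Cst c => Cst V c end.

Lemma tvar_name_term n t : tvar (name_term n t) `<=` range v.
Proof. by case: t => [k|c] x //= ->; exists (n + k)%N. Qed.

Lemma teval_name_term n t d (B : ctbDistrLatticeType d) (M : bmodel L B)
    (e : V -> M) : teval e (name_term n t) = teval (fun k => e (v (n + k))) t.
Proof. by case: t. Qed.

Lemma range_occurs_in : range v `<=` occurs_in A.
Proof. by move=> _ [i _ <-]; apply: occurs_in_var. Qed.

Lemma FV_and2 (p q : formula L V) : FV (and2 p q) = FV p `|` FV q.
Proof.
apply/seteqP; split=> [x [[] _ ?]|x []]; [by left|by right| |].
  by exists true.
by exists false.
Qed.

Lemma condition_formula n (q : condition) :
  exists p, [/\ A p, FV p `<=` range v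
    & forall d (B : ctbDistrLatticeType d) (M : bmodel L B) (e : V -> M),
        complete_boolean B ->
        value e p = cond_value q (fun k => e (v (n + k)))].
Proof.
elim: q => [|c q [p [Ap pv vp]]].
  exists (Eq (Var L (v 0)) (Var L (v 0))); split.
  - by apply: A_eq; exists 0%N, 0%N.
  - by move=> x [] /= ->; exists 0%N.
  - by move=> d B M e cB; rewrite /cond_value big_nil /= beq_refl.
have [r [Ar rv vr]] := fragment_instance v_inj A_frag A_eq
  (f := fun x => name_term n (st_names c x)) (st_fragment c)
  (fun x _ => @tvar_name_term n (st_names c x)).
exists (and2 r p); split; first exact: (frag_and A_frag).
  rewrite FV_and2 subUset; split=> // x /rv[y _]; exact: tvar_name_term.
move=> d B M e cB; rewrite value_and2// -cat1s cond_value_cat cond_value1 -vp// vr//.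
congr (_ `&` _); apply: value_eq => // x _; exact: teval_name_term.
Qed.

Lemma tuple_formula n (s : V -> name) (r : seq nat) :
  exists p, [/\ A p, FV p `<=` range v
    & forall d (B : ctbDistrLatticeType d) (M : bmodel L B) (e : V -> M),
        complete_boolean B -> value e p = \meet_(i <- r)
          beq (e (v i)) (teval (fun k => e (v (n + k))) (s (v i)))].
Proof.
elim: r => [|i r [p [Ap pv vp]]].
  have [p [Ap pv vp]] := condition_formula 0 [::].
  exists p; split=> // d B M e cB.
  by rewrite vp// /cond_value !big_nil.
have iv : tvar (Var L (v i)) `<=` range v by move=> x ->; exists i.
exists (and2 (Eq (Var L (v i)) (name_term n (s (v i)))) p); split.
- apply: (frag_and A_frag) => //; apply: (fragment_Eq v_inj A_frag A_eq).
    exact: subset_trans range_occurs_in.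
  by apply: subset_trans range_occurs_in; apply: tvar_name_term.
- by rewrite FV_and2 !subUset; do !split=> //; apply: tvar_name_term.
- move=> d B M e cB; rewrite value_and2// big_cons vp//=.
  by rewrite teval_name_term.
Qed.

Lemma first_varsP n x : x \in first_vars v n <-> exists2 i, (i < n)%N & x = v i.
Proof.
split=> [/imfsetP[i /= + ->]|[i ni ->]]; first by rewrite mem_iota => ?; exists i.
by apply/imfsetP; exists i => //=; rewrite mem_iota.
Qed.

Lemma sub_first_vars (p : formula L V) : Linf p -> FV p `<=` range v ->
  exists m, FV p `<=` [set` first_vars v m].
Proof.
move=> /Linf_FV_finite/finite_seqP[xs ->] xv; have [N NP] := var_fresh v_inj xs.
exists N => x /= xx; apply/first_varsP; have [i _ vi] := xv x xx.
exists i; last by rewrite vi.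
by rewrite ltnNge; apply/negP => Ni; have := NP (i - N)%N; rewrite subnKC// vi xx.
Qed.

Lemma extend_env d (B : ctbDistrLatticeType d) (M : bmodel L B) (g : nat -> M) :
  exists e : V -> M, forall i, e (v i) = g i.
Proof.
exists (fun x => if pselect (exists i, x = v i) is left h then g (projT1 (cid h))
                 else g 0%N) => i.
case: pselect => [h|[]]; last by exists i.
by congr g; apply/v_inj/esym/(projT2 (cid h)).
Qed.

Lemma consistent_cond q : ~ inconsistent q ->
  exists d (B : ctbDistrLatticeType d) (M : bmodel L B) (e : nat -> M),
    [/\ complete_boolean B, models M T & cond_value q e != \bot].
Proof.
move=> qn; apply: contrapT => h; apply: qn => d B M cB MT e.
rewrite lex0; apply: contrapT => /negP q0; apply: h.
by exists d, B, M, e.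
Qed.

(** This is a density statement: each consistent condition has a consistent extension that asserts a
    member of the type at the names [s]. *)
Lemma omit_type (J : Type) (I : J -> Type) (n : J -> nat)
    (Phi : forall j : J, I j -> formula L V)
    (Phi_FV : forall j i, FV (Phi j i) `<=` [set` first_vars v (n j)])
    (PhiA : forall j i, A (Phi j i))
    (omitted : forall (j : J) (theta : formula L V) (m : nat),
       A theta -> FV theta `<=` [set` first_vars v m] ->
       boolean_satisfiable (T `|` [set Ex (first_vars v m) theta]) ->
       exists i : I j, boolean_satisfiable
          (T `|` [set Ex (first_vars v (maxn m (n j)))
                         (and2 theta (Phi j i))]))
    (j : J) (s : V -> name) (q : condition) :
  ~ inconsistent q ->
  exists i, ~ inconsistent (Statement s (PhiA j i) :: q).
Proof.
move=> /consistent_cond[d [B [M [e [cB MT q0]]]]].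
have [p1 [Ap1 p1v vp1]] := condition_formula (n j) q.
have [p2 [Ap2 p2v vp2]] := tuple_formula (n j) s (iota 0 (n j)).
pose theta := and2 p1 p2.
have At : A theta by apply: (frag_and A_frag).
have [m tm] : exists m, FV theta `<=` [set` first_vars v m].
  apply: sub_first_vars; first exact: (frag_Linf A_frag).
  by rewrite FV_and2 subUset.
(* The first [n j] variables take the values of the tuple named by [s], and the later ones follow
   [e] shifted by [n j]. Hence [theta] has the nonzero value of [q] at [e]. *)
have [e' e'P] := extend_env
  (fun k => if (k < n j)%N then teval e (s (v k)) else e (k - n j)%N).
have ee' : (fun k => e' (v (n j + k))) = e.
  by apply/funext => k; rewrite e'P ltnNge leq_addr addKn.
have vt : value e' theta != \bot.
  rewrite value_and2// vp1// ee' vp2// ee' big_seq big1 ?meetx1// => i.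
  by rewrite mem_iota /= => ni; rewrite e'P ni beq_refl.
have [i] := omitted j theta m At tm (satisfiable_ex cB MT tm vt).
move=> [d' [B' [M' [cB' M'T]]]]; exists i => inc.
have [y] := dom_inh M'.
have := (modelsP cB' M' _).1 M'T (fun=> y) _ (or_intror erefl).
suff : value (fun=> y) (Ex (first_vars v (maxn m (n j))) (and2 theta (Phi j i))) <= \bot.
  by move=> + vtop; rewrite vtop lex0 eq_sym; apply/negP; case: cB'.
have M'T0 : models M' T.
  by apply/modelsP => // h r Tr; apply: (modelsP cB' M' _).1 M'T _ _ (or_introl Tr).
(* A witness [g] is read back as an interpretation [k] of the names. *)
apply: sup_le => // _ [g _ <-]; pose k l := g (v (n j + l)).
apply: le_trans (inc d' B' M' cB' M'T0 k).
rewrite -[X in X <= _]/(value g (and2 _ _)) !value_and2// vp1//.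
rewrite -cat1s cond_value_cat cond_value1 -meetA meetC leI2//.
(* The equalities in [theta] identify the values of [g] at the free variables of [Phi j i] with the
   elements named by [s]. *)
apply: value_congr => // x /Phi_FV /first_varsP[l ln ->].
rewrite vp2//; apply: meets_inf_seq => //.
by rewrite mem_iota.
Qed.

End GenericModel.

Theorem theorem3p5 (L : signature) (V : choiceType) (v : nat -> V)
    (v_inj : injective v)
    (T : set (formula L V))
    (T_sent : forall p, T p -> sentence p)
    (T_sat : boolean_satisfiable T)
    (* F = {Phi j | j : J} and Phi j = {Phi j i | i : I j} *)
    (J : Type) (I : J -> Type) (n : J -> nat)
    (Phi : forall j : J, I j -> formula L V)
    (Phi_Linf : forall j i, Linf (Phi j i))
    (Phi_FV : forall j i, FV (Phi j i) `<=` [set` first_vars v (n j)])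
    (A : set (formula L V))
    (A_smallest : smallest_fragment
       (T `|` (\bigcup_j range (Phi j)) `|` var_equalities v) A)
    (types_omitted : forall (j : J) (theta : formula L V) (m : nat),
       A theta -> FV theta `<=` [set` first_vars v m] ->
       (boolean_satisfiable (T `|` [set Ex (first_vars v m) theta]) <->
        exists i : I j, boolean_satisfiable
          (T `|` [set Ex (first_vars v (maxn m (n j)))
                         (and2 theta (Phi j i))]))) :
  exists (d : Order.disp_t) (B : ctbDistrLatticeType d) (M : bmodel L B),
    [/\ complete_boolean B, mixing M
      & models M
          (T `|` [set And (fun j : J =>
                             All (first_vars v (n j)) (Or (Phi j)))])].
Proof.
have [A_frag X_A _] := A_smallest.
have TA : T `<=` A by move=> p Tp; apply: X_A; left; left.
have PhiA j i : A (Phi j i) by apply: X_A; left; right; exists j => //; exists i.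
have A_eq : var_equalities v `<=` A by move=> p vp; apply: X_A; right.
have cC := reg_complete (conditions_nontrivial A T_sat).
pose N := generic_model v_inj T A_frag A_eq.
have [e0] : inhabited (V -> N) by have [x] := dom_inh N; constructor => y.
exists reg_display, _, (mix_model cC N); split=> //; first exact: mix_model_mixing.
(* A formula without free variables may be evaluated at an assignment of names, where [mix_value]
   removes the mixtures. *)
have closed e p : FV p = set0 -> value (M := mix_model cC N) e p = value e0 p.
  move=> p0; rewrite -(mix_value cC e0); apply: value_eq => // x.
  by rewrite p0.
have truth := @generic_truth L V v v_inj T A A_frag A_eq T_sat.
apply/(modelsP cC) => e p [Tp|->].
  rewrite closed; last by have [] := T_sent p Tp.
  apply/reg_topP => q; apply/(truth p (TA p Tp)) => d B M cB MT k.
  by rewrite /inst_value ((modelsP cB M T).1 MT)// lex1.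
rewrite closed; last first.
  apply/seteqP; split=> // x [j _ [[i _ /Phi_FV xv]]]; exact.
(* The conjunction over [J] need not belong to [A], so its outer connectives are evaluated in the
   algebra and [truth] is applied only to the members of the types. *)
apply/(inf_eq1 cC) => _ [j _ <-]; apply/(inf_eq1 cC) => _ [s _ <-].
apply/reg_topP => q; apply/(reg_supP (conditions_nontrivial A T_sat)) => r rX.
(* It suffices that a condition [r] incompatible with every instance is inconsistent; otherwise
   [omit_type] gives an instance consistent with [r]. *)
apply/nullW; apply: contrapT => rn.
have omitted j' theta m At tm := (types_omitted j' theta m At tm).1.
have [i] := omit_type v_inj A_frag A_eq Phi_FV PhiA omitted j s rn.
apply; apply: entails_value_perp => r' /(truth _ (PhiA j i)) r'X.
by apply: (rX _ _ r' r'X); exists i.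
Qed.
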